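(* (Rice) Let $A\subseteq\omega$ be an infinite c.e. set, $n\ge1$, and let $\theta^{(n)}$ be a quasi-Gödel numbering of $\mathcal S^{(n)}_A$. Let $C\subseteq\mathcal S^{(n)}_A$. Then the index set $\{i\in\omega:\theta^{(n)}_i\in C\}$ is computable if, and only if, $C=\emptyset$ or $C=\mathcal S^{(n)}_A$.
   Context: $\omega$ is the set of natural numbers; $\mathcal R^{(n)}$ is the set of total computable functions $\omega^n\to\omega$. $\langle\cdot,\cdot\rangle:\omega^2\to\omega$ is a computable bijection with $\langle x,y\rangle\ge x,y$, extended by $\langle x\rangle=x$, $\langle x_1,\dots,x_{n+1}\rangle=\langle x_1,\langle x_2,\dots,x_{n+1}\rangle\rangle$. $\mathrm{Anf}^{(n)}_A$ is the set of partial functions from $\omega^n$ to $\omega$ whose domain is either empty or equal to $\{0,\dots,a-1\}^n$ for some $a\in A$, and $\mathcal S^{(n)}_A=\mathcal R^{(n)}\cup\mathrm{Anf}^{(n)}_A$. The extended graph of an $n$-ary partial function $q$ is $\{\langle\langle\vec y\rangle,0\rangle:\vec y\in\omega^n\}\cup\{\langle\langle\vec x\rangle,q(\vec x)+1\rangle:\vec x\in\mathrm{dom}(q)\}$. A numbering of a set $X$ is a surjection $\omega\to X$. A numbering $\theta$ of $\mathcal S^{(n)}_A$ is a quasi-Gödel numbering if: (QGN I) the extended graph of $(i,\vec x)\mapsto\theta_i(\vec x)$ is the range of a function in $\mathcal R^{(1)}$; and (QGN II) for every $k\in\mathcal R^{(2)}$ there is $v\in\mathcal R^{(1)}$ such that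 for all $i\in\omega$, $r\in\mathcal S^{(n)}_A$: if $\{k(i,t):t\in\omega\}$ is the extended graph of $r$, then $r=\theta_{v(i)}$. *)

(* Defs.v *)
From mathcomp Require Import all_boot.
From mathcomp Require Import boolp classical_sets cardinality.

Set Implicit Arguments.
Unset Strict Implicit.
Unset Printing Implicit Defensive.

Local Open Scope classical_set_scope.

(* Schemes for partial mu-recursive functions, indexed by arity. *)
Inductive murec : nat -> Type :=
| MZero : murec 0
| MSucc : murec 1
| MProj n : 'I_n -> murec n
| MComp m n : murec m -> ('I_m -> murec n) -> murec n
| MRec n : murec n -> murec n.+2 -> murec n.+1
| MMin n : murec n.+1 -> murec n.

(* [meval p x y]: the partial function described by [p] is defined at [x], with
   value [y].  Recursion and minimisation act on the first argument; the step
   function of a recursion takes the counter, the previous value and the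
   parameters, in this order.  Minimisation requires the function to be defined
   at all arguments below the zero found. *)
Fixpoint meval n (p : murec n) : n.-tuple nat -> nat -> Prop :=
  match p with
  | MZero => fun _ y => y = 0
  | MSucc => fun x y => y = (thead x).+1
  | MProj _ i => fun x y => y = tnth x i
  | MComp m _ g fs => fun x y =>
      exists z : m.-tuple nat, (forall i, meval (fs i) x (tnth z i)) /\ meval g z y
  | MRec _ f g => fun x =>
      let u := behead_tuple x in
      (fix rec c y := match c with
        | 0 => meval f u y
        | c'.+1 => exists2 z, rec c' z & meval g [tuple of c' :: z :: u] y
        end) (thead x)
  | MMin _ f => fun x y =>
      meval f [tuple of y :: x] 0 /\
      forall z, z < y -> exists w, meval f [tuple of z :: x] w.+1
  end.

Definition Rfun n : set (n.-tuple nat -> nat) :=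
  [set f | exists p : murec n, forall x, meval p x (f x)].

Definition computable_set (X : set nat) : Prop :=
  Rfun (fun x : 1.-tuple nat => nat_of_bool `[< X (thead x) >]).

Definition ce_set (X : set nat) : Prop :=
  X = set0 \/ exists2 f : 1.-tuple nat -> nat, Rfun f & X = range f.

Definition partial_fun n := n.-tuple nat -> option nat.

Definition pdom n (q : partial_fun n) : set (n.-tuple nat) :=
  [set x | exists y, q x = Some y].

Definition Anf n (A : set nat) : set (partial_fun n) :=
  [set q | pdom q = set0 \/
           exists2 a, A a & pdom q = [set x | forall i, tnth x i < a]].

Definition SA n (A : set nat) : set (partial_fun n) :=
  [set (fun x => Some (f x)) | f in @Rfun n] `|` @Anf n A.

Definition is_pairing (pr : nat -> nat -> nat) : Prop :=
  [/\ Rfun (fun x : 2.-tuple nat => pr (tnth x ord0) (tnth x ord_max)),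
      bijective (fun z : nat * nat => pr z.1 z.2)
    & forall x y, x <= pr x y /\ y <= pr x y].

(* The value on the empty sequence is irrelevant: codes are only taken of tuples
   of positive length. *)
Fixpoint code (pr : nat -> nat -> nat) (s : seq nat) : nat :=
  match s with
  | [::] => 0
  | x :: s' => if s' is [::] then x else pr x (code pr s')
  end.

Definition ext_graph pr n (q : partial_fun n) : set nat :=
  [set pr (code pr y) 0 | y in [set: n.-tuple nat]] `|`
  [set z | exists x w, q x = Some w /\ z = pr (code pr x) w.+1].

Definition numbering T (X : set T) (theta : nat -> T) : Prop := range theta = X.

Definition QGN1 pr n (theta : nat -> partial_fun n) : Prop :=
  exists2 f : 1.-tuple nat -> nat, Rfun f &
    ext_graph pr (fun x : n.+1.-tuple nat => theta (thead x) (behead_tuple x))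
    = range f.

Definition QGN2 pr n (A : set nat) (theta : nat -> partial_fun n) : Prop :=
  forall k : 2.-tuple nat -> nat, Rfun k ->
  exists2 v : 1.-tuple nat -> nat, Rfun v &
    forall (i : nat) (r : partial_fun n), SA A r ->
      range (fun t => k [tuple i; t]) = ext_graph pr r ->
      r = theta (v [tuple i]).

Definition quasi_Goedel pr n (A : set nat) (theta : nat -> partial_fun n) : Prop :=
  [/\ numbering (@SA n A) theta, QGN1 pr theta & QGN2 pr A theta].

(* Main.v *)
Require Import Defs.
From mathcomp Require Import all_boot.
From mathcomp Require Import boolp classical_sets cardinality.

(** Diagonalisation in the style of the recursion theorem, with [theta] itself
    as the universal function.  Let [q0] be the nowhere defined function and
    suppose the index set of [C] is computable while some [r] lies on the other
    side of [C] than [q0].  Dovetailing, enumerate the extended graph of [r] if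
    [theta_i (i, ..., i)] turns out to be defined with a value that is an index
    on the side of [q0], and that of [q0] otherwise.  QGN II turns this
    enumeration into a total computable [v].  As [x |-> v (x_1)] is some
    [theta_m], the function [theta_(v m)] lies on the side of [q0] if and only
    if it equals [r], which is absurd. *)

Set Implicit Arguments.
Unset Strict Implicit.
Unset Printing Implicit Defensive.

Local Open Scope classical_set_scope.

(** * Closure properties of the total computable functions *)

Lemma behead_cons_tuple T n (a : T) (u : n.-tuple T) :
  behead_tuple [tuple of a :: u] = u.
Proof. exact: val_inj. Qed.

Lemma Rfun_ext n (f g : n.-tuple nat -> nat) : f =1 g -> Rfun f -> Rfun g.
Proof. by move=> fg [p hp]; exists p => x; rewrite -fg. Qed.

Lemma Rfun_proj n (i : 'I_n) : Rfun (fun x : n.-tuple nat => tnth x i).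
Proof. by exists (MProj i). Qed.

Lemma Rfun_comp m n (g : m.-tuple nat -> nat)
    (fs : 'I_m -> n.-tuple nat -> nat) :
  Rfun g -> (forall i, Rfun (fs i)) ->
  Rfun (fun x => g [tuple fs i x | i < m]).
Proof.
move=> [pg hg] /choice[ps hps].
exists (MComp pg ps) => x /=; exists [tuple fs i x | i < m].
by split=> // i; rewrite tnth_mktuple.
Qed.

Lemma Rfun_comp1 n (g : 1.-tuple nat -> nat) (f : n.-tuple nat -> nat) :
  Rfun g -> Rfun f -> Rfun (fun x => g [tuple f x]).
Proof.
move=> hg hf; apply: Rfun_ext (Rfun_comp (fs := fun=> f) hg (fun=> hf)) => x.
by congr g; apply: eq_from_tnth => i; rewrite tnth_mktuple ord1.
Qed.

Lemma Rfun_comp2 n (g : 2.-tuple nat -> nat) (f1 f2 : n.-tuple nat -> nat) :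
  Rfun g -> Rfun f1 -> Rfun f2 -> Rfun (fun x => g [tuple f1 x; f2 x]).
Proof.
move=> hg h1 h2.
have hf (i : 'I_2) : Rfun (if i == ord0 then f1 else f2) by case: ifP.
apply: Rfun_ext (Rfun_comp hg hf) => x.
congr g; apply: eq_from_tnth => i; rewrite tnth_mktuple.
by case: i => -[|[|//]] i.
Qed.

Lemma Rfun_thead n : Rfun (fun x : n.+1.-tuple nat => thead x).
Proof. exact: Rfun_proj. Qed.

Lemma Rfun_behead n (f : n.-tuple nat -> nat) :
  Rfun f -> Rfun (fun x : n.+1.-tuple nat => f (behead_tuple x)).
Proof.
move=> hf.
apply: Rfun_ext (Rfun_comp hf (fun i => Rfun_proj (lift ord0 i))) => x.
congr f; apply: eq_from_tnth => i; rewrite tnth_mktuple tnth_behead.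
by congr tnth; apply: val_inj; rewrite /= inordK // ltnS.
Qed.

Lemma Rfun_succ n (f : n.-tuple nat -> nat) :
  Rfun f -> Rfun (fun x => (f x).+1).
Proof.
by apply: (@Rfun_comp1 _ (fun x => (thead x).+1)); exists MSucc.
Qed.

Lemma Rfun_const n c : Rfun (fun _ : n.-tuple nat => c).
Proof.
elim: c => [|c IHc]; last exact: Rfun_succ IHc.
apply: (@Rfun_comp 0 n (fun=> 0) (fun=> fun=> 0)); last by case.
by exists MZero.
Qed.

(** The scheme [MRec] recurses on the first argument, giving [F]; composing [F] with the tuple made
    of [k x] followed by [x] yields recursion up to a computable bound. *)
Lemma Rfun_rec n (k f : n.-tuple nat -> nat)
    (g : nat -> nat -> n.-tuple nat -> nat) :
  Rfun k -> Rfun f ->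
  Rfun (fun x : n.+2.-tuple nat =>
          g (thead x) (thead (behead_tuple x))
            (behead_tuple (behead_tuple x))) ->
  Rfun (fun x => nat_rect (fun=> nat) (f x) (fun c r => g c r x) (k x)).
Proof.
move=> hk [pf hf] [pg hg].
pose F (x : n.+1.-tuple nat) :=
  nat_rect (fun=> nat) (f (behead_tuple x))
    (fun c r => g c r (behead_tuple x)) (thead x).
have hF : Rfun F.
  exists (MRec pf pg) => x; rewrite /F /=.
  elim: (thead x) => [|c IHc] /=; first exact: hf.
  eexists; first exact: IHc.
  set y := cons_tuple _ _; have := hg y.
  by rewrite {2 3 4}/y !behead_cons_tuple.
have hk' (i : 'I_n.+1) :
    Rfun (if unlift ord0 i is Some j then fun x => tnth x j else k).
  by case: unlift => [j|]; [exact: Rfun_proj | exact: hk].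
apply: Rfun_ext (Rfun_comp hF hk') => x; rewrite /F.
set y := mktuple _.
have -> : thead y = k x by rewrite /thead tnth_mktuple unlift_none.
suff -> : behead_tuple y = x by [].
apply: eq_from_tnth => i; rewrite tnth_behead tnth_mktuple.
have -> : inord i.+1 = lift ord0 i by apply: val_inj; rewrite /= inordK // ltnS.
by rewrite liftK.
Qed.

(** As [F x] is the only zero, it is the least one, and totality of [h] supplies the positive values
    that [MMin] demands below it. *)
Lemma Rfun_min n (h : nat -> n.-tuple nat -> nat) (F : n.-tuple nat -> nat) :
  Rfun (fun x : n.+1.-tuple nat => h (thead x) (behead_tuple x)) ->
  (forall x y, h y x = 0 <-> y = F x) -> Rfun F.
Proof.
move=> [p hp] hF; exists (MMin p) => x /=; split.
  have := hp [tuple of F x :: x].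
  by rewrite behead_cons_tuple (_ : thead _ = F x) // (proj2 (hF _ _)).
move=> y yF; exists (h y x).-1; rewrite prednK.
  by have := hp [tuple of y :: x]; rewrite behead_cons_tuple.
by rewrite lt0n; apply/eqP => /hF yE; rewrite yE ltnn in yF.
Qed.

(** A case distinction is a recursion of length [t x] whose step ignores the previous value. *)
Lemma Rfun_if n (t f g : n.-tuple nat -> nat) :
  Rfun t -> Rfun f -> Rfun g -> Rfun (fun x => if t x == 0 then f x else g x).
Proof.
move=> ht hf hg.
apply: Rfun_ext (Rfun_rec (g := fun=> fun=> g) ht hf _) => [x|].
  by case: (t x).
exact: Rfun_behead (Rfun_behead hg).
Qed.

Lemma Rfun_pred n (f : n.-tuple nat -> nat) :
  Rfun f -> Rfun (fun x => (f x).-1).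
Proof.
move=> hf.
apply: Rfun_ext (Rfun_rec (g := fun c _ _ => c) hf (Rfun_const n 0) _) => [x|].
  by case: (f x).
exact: Rfun_thead.
Qed.

Lemma Rfun_sub n (f g : n.-tuple nat -> nat) :
  Rfun f -> Rfun g -> Rfun (fun x => f x - g x).
Proof.
move=> hf hg.
apply: Rfun_ext (Rfun_rec (g := fun _ r _ => r.-1) hg hf _) => [x|].
  by elim: (g x) => [|c IHc] /=; rewrite ?subn0 // subnS IHc.
exact: Rfun_pred (Rfun_behead (Rfun_thead n)).
Qed.

(** Inequality rather than equality, because [Rfun_if] and [Rfun_min] test for the value 0. *)
Lemma Rfun_neq n (f g : n.-tuple nat -> nat) :
  Rfun f -> Rfun g -> Rfun (fun x => (f x != g x) : nat).
Proof.
move=> hf hg.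
apply: Rfun_ext (Rfun_if (Rfun_sub hf hg)
  (Rfun_if (Rfun_sub hg hf) (Rfun_const n 0) (Rfun_const n 1))
  (Rfun_const n 1)) => x.
by rewrite !subn_eq0 eqn_leq; do 2 case: leq.
Qed.

(** * Unpairing, codes of tuples and enumerations of extended graphs *)

Section Pairing.
Variables (pr : nat -> nat -> nat) (hpr : is_pairing pr).

Lemma pairing_Rfun n (f g : n.-tuple nat -> nat) :
  Rfun f -> Rfun g -> Rfun (fun x => pr (f x) (g x)).
Proof. by case: hpr => h _ _; exact: Rfun_comp2 h. Qed.

Lemma pairing_inj x y x' y' : pr x y = pr x' y' -> x = x' /\ y = y'.
Proof.
case: hpr => _ /bij_inj inj _ e.
by case: (inj (x, y) (x', y') e).
Qed.

(** Minimisation searches for one unknown only. The second component is found first, with a bounded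
    inner search for the first one; once it is computable, the first component is the unique zero of
    another search. *)
Lemma Rfun_unpair :
  exists L R : nat -> nat,
    [/\ forall z, pr (L z) (R z) = z, forall x y, L (pr x y) = x,
        forall x y, R (pr x y) = y,
        forall n (f : n.-tuple nat -> nat), Rfun f -> Rfun (fun x => L (f x)) &
        forall n (f : n.-tuple nat -> nat), Rfun f -> Rfun (fun x => R (f x))].
Proof.
have [_ [u prK uK] lepr] := hpr.
have pu z : pr (u z).1 (u z).2 = z by exact: uK.
have u1 x y : (u (pr x y)).1 = x by rewrite (prK (x, y)).
have u2 x y : (u (pr x y)).2 = y by rewrite (prK (x, y)).
have comp1 (F : nat -> nat) : Rfun (fun x : 1.-tuple nat => F (thead x)) ->
    forall n (f : n.-tuple nat -> nat), Rfun f -> Rfun (fun x => F (f x)).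
  by move=> hF n f hf; exact: Rfun_comp1 hF hf.
have thead2 n : Rfun (fun x : n.+2.-tuple nat => thead (behead_tuple x)).
  exact: Rfun_behead (Rfun_thead n).
have thead3 n :
    Rfun (fun x : n.+3.-tuple nat => thead (behead_tuple (behead_tuple x))).
  exact: Rfun_behead (thead2 n).
have thead4 n : Rfun (fun x : n.+4.-tuple nat =>
    thead (behead_tuple (behead_tuple (behead_tuple x)))).
  exact: Rfun_behead (thead3 n).
(* [absent b y z = 0] iff [z = pr x y] for some [x < b]. *)
pose absent b y z := nat_rect (fun=> nat) 1
  (fun c r => if r == 0 then 0 else (pr c y != z) : nat) b.
have absentP b y z : absent b y z = 0 <-> exists2 x, x < b & pr x y = z.
  elim: b => [|b IHb]; first by split=> // -[].
  rewrite /absent /= -/(absent b y z); split.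
    case: eqP => [/IHb[x xb e] _|_].
      by exists x => //; exact: ltnW.
    by case: eqP => // e _; exists b.
  move=> [x]; rewrite ltnS leq_eqVlt => /orP[/eqP->|xb] e.
    by rewrite e eqxx; case: ifP.
  by rewrite (proj2 IHb) //; exists x.
have hR : Rfun (fun x : 1.-tuple nat => (u (thead x)).2).
  (* The strict bound [z.+1] suffices for the inner search, since both components of [z] are at most
     [z]. *)
  apply: (@Rfun_min 1 (fun y x => absent (thead x).+1 y (thead x))).
    apply: (Rfun_rec (n := 2)
      (g := fun c r x => if r == 0 then 0 else
                         (pr c (thead x) != thead (behead_tuple x)) : nat)).
    - exact: Rfun_succ.
    - exact: Rfun_const.
    - apply: Rfun_if => //; first exact: Rfun_const.
      apply: Rfun_neq => //; apply: pairing_Rfun => //; exact: Rfun_thead.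
  move=> x y; rewrite absentP; split=> [[a _ <-]//|->].
  by exists (u (thead x)).1; rewrite // ltnS -[leqRHS]pu;
    case: (lepr (u (thead x)).1 (u (thead x)).2).
have hL : Rfun (fun x : 1.-tuple nat => (u (thead x)).1).
  apply: (@Rfun_min 1 (fun y x => (pr y (u (thead x)).2 != thead x) : nat)).
    apply: Rfun_neq => //.
    exact: pairing_Rfun (Rfun_thead 1) (Rfun_behead hR).
  move=> x y; split=> [|->]; last by rewrite pu eqxx.
  by case: eqP => // <- _; rewrite u1.
exists (fun z => (u z).1), (fun z => (u z).2); split=> //.
  exact: (comp1 (fun z => (u z).1)).
exact: (comp1 (fun z => (u z).2)).
Qed.

Lemma code_cons a b s : code pr [:: a, b & s] = pr a (code pr (b :: s)).
Proof. by []. Qed.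

(** Codes do not determine the length: [[:: pr a b]] and [[:: a; b]] have the same code. *)
Lemma code_inj s t : size s = size t -> code pr s = code pr t -> s = t.
Proof.
elim: s t => [|a s IHs] [|b t] //= [st].
case: s t st IHs => [|c s] [|d t] // st IHs; first by move->.
by move=> /pairing_inj[-> /(IHs _ st)->].
Qed.

Lemma code_surj n c : exists y : n.+1.-tuple nat, code pr y = c.
Proof.
elim: n c => [|n IHn] c; first by exists [tuple c].
have [L [R [pu _ _ _ _]]] := Rfun_unpair.
have [y ey] := IHn (R c); exists [tuple of L c :: y].
by case/tupleP: y ey => b y; rewrite code_cons => ->.
Qed.

Lemma Rfun_code_nseq m n (f : m.-tuple nat -> nat) :
  Rfun f -> Rfun (fun x => code pr (nseq n.+1 (f x))).
Proof. by move=> hf; elim: n => // n IHn; exact: pairing_Rfun. Qed.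

(** Every number codes a tuple of positive length, so [pr c 0] is a neutral output for an
    enumeration with nothing to report. *)
Lemma ext_graph0 n (q : partial_fun n.+1) c : ext_graph pr q (pr c 0).
Proof. by left; have [y <-] := code_surj n c; exists y. Qed.

(** Filter the enumeration of the universal extended graph: entries with index [j] lose that index,
    all others become the neutral [pr 0 0]. *)
Lemma QGN1_ext_graph_enum n (theta : nat -> partial_fun n.+1) j :
  QGN1 pr theta ->
  exists2 g : 1.-tuple nat -> nat, Rfun g & ext_graph pr (theta j) = range g.
Proof.
move=> [f hf ef].
have [L [R [pu Lpr Rpr hL hR]]] := Rfun_unpair.
pose g x := if (L (L (f x)) != j : nat) == 0 then pr (R (L (f x))) (R (f x))
            else pr 0 0.
exists g.
  apply: Rfun_if; last exact: Rfun_const.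
    exact: Rfun_neq (hL _ _ (hL _ _ hf)) (Rfun_const 1 j).
  exact: pairing_Rfun (hR _ _ (hL _ _ hf)) (hR _ _ hf).
have gE x s w : f x = pr (pr j s) w -> g x = pr s w.
  by move=> fx; rewrite /g fx !(Lpr, Rpr) eqxx.
have cE i (x : n.+1.-tuple nat) : code pr [tuple of i :: x] = pr i (code pr x).
  by case/tupleP: x.
apply/seteqP; split=> c /=.
  have inf s w : range f (pr (pr j s) w) -> range g (pr s w).
    by move=> [x _ fx]; exists x => //; exact: gE.
  move=> [[y _ <-]|[x [w [qx ->]]]]; apply: inf; rewrite -ef -cE.
    by left; exists [tuple of j :: y].
  by right; exists [tuple of j :: x], w; rewrite behead_cons_tuple.
move=> [x _ <-]; rewrite /g.
have [Lj|_] := eqVneq (L (L (f x))) j; last exact: ext_graph0.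
have : range f (f x) by exists x.
rewrite -ef => -[[y _]|[y [w [+ fy]]]].
  case/tupleP: y => a y <-; rewrite cE !(Lpr, Rpr); exact: ext_graph0.
case/tupleP: y fy => a y fy; rewrite behead_cons_tuple => qy.
rewrite fy cE !Lpr in Lj; rewrite fy cE !(Lpr, Rpr).
by right; exists y, w; rewrite -Lj.
Qed.

End Pairing.

(** * The diagonal argument and Rice's theorem *)

Lemma quasi_Goedel_diagonal pr (hpr : is_pairing pr) A n
    (theta : nat -> partial_fun n.+1) (I : set nat) (r : partial_fun n.+1) :
  computable_set I -> quasi_Goedel pr A theta -> SA A r ->
  exists i, theta i = if `[< I i >] then r else fun=> None.
Proof.
move=> hI [range_theta hth1 hth2] hr.
have [L [R [pu Lpr Rpr hL hR]]] := Rfun_unpair hpr.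
have [j _ rj] : range theta r by rewrite range_theta.
have [g hg eg] := QGN1_ext_graph_enum hpr j hth1; rewrite rj in eg.
have [f hf ef] := hth1.
pose chi y : nat := `[< I y >].
pose idx (x : 2.-tuple nat) := tnth x ord0.
pose time (x : 2.-tuple nat) := tnth x ord_max.
have hidx : Rfun idx by exact: Rfun_proj.
have htime : Rfun time by exact: Rfun_proj.
pose z x := f [tuple L (time x)].
have hz : Rfun z by apply: Rfun_comp1 => //; exact: hL.
pose idle x := pr (R (time x)) 0.
have hidle : Rfun idle.
  by apply: pairing_Rfun => //; [exact: hR | exact: Rfun_const].
(* Time is a pair: at stage [L (time x)] of [f], look for a value in [I] of [theta i] at
   [(i, ..., i)]; the [n.+2] copies are the index and its [n.+1] arguments. The second component 0
   carries no value, and a value [w] is stored as [w.+1]. [R (time x)] selects the output. *)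
pose k x :=
  if (L (z x) != code pr (nseq n.+2 (idx x)) : nat) == 0 then
    if R (z x) == 0 then idle x else
    if chi (R (z x)).-1 == 0 then idle x else g [tuple R (time x)]
  else idle x.
have hk : Rfun k.
  have hRz : Rfun (fun x => R (z x)) by exact: hR.
  apply: Rfun_if => //.
    by apply: Rfun_neq; [exact: hL | exact: Rfun_code_nseq].
  apply: Rfun_if => //; apply: Rfun_if => //.
    exact: (Rfun_comp1 hI (Rfun_pred hRz)).
  by apply: Rfun_comp1 => //; exact: hR.
have kE i a b : k [tuple i; pr a b] =
    if [&& L (f [tuple a]) == code pr (nseq n.+2 i), R (f [tuple a]) != 0 &
         `[< I (R (f [tuple a])).-1 >]]
    then g [tuple b] else pr b 0.
  rewrite /k /z /idle /time (_ : tnth _ _ = pr a b) // (_ : idx _ = i) //.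
  rewrite !(Lpr, Rpr) /chi.
  by case: (_ == code pr _) => //; case: (R _ == 0) => //; case: asbool.
have [v hv hvk] := hth2 k hk.
have hvx : Rfun (fun x : n.+1.-tuple nat => v [tuple thead x]).
  exact: Rfun_comp1 hv (Rfun_thead n).
have [m _ thm] : range theta (fun x => Some (v [tuple thead x])).
  by rewrite range_theta; left; exists (fun x => v [tuple thead x]).
(* At the index [m] the search can only find the value [v [tuple m]]. *)
have searchE a : L (f [tuple a]) = code pr (nseq n.+2 m) ->
    R (f [tuple a]) != 0 -> (R (f [tuple a])).-1 = v [tuple m].
  have : range f (f [tuple a]) by exists [tuple a].
  rewrite -ef => -[[y _ <-]|[x [w [qx ->]]]]; first by rewrite Rpr eqxx.
  rewrite Lpr Rpr => /(code_inj hpr).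
  rewrite size_tuple size_nseq => /(_ erefl) ex _ /=.
  have xE : x = [tuple of m :: nseq_tuple n.+1 m] by apply: val_inj.
  by move: qx; rewrite xE behead_cons_tuple thm => -[<-].
exists (v [tuple m]); apply/esym/hvk.
  by case: ifP => // _; right; left; apply/seteqP; split=> x // [].
case: asboolP => [Iv|nIv]; apply/seteqP; split=> c.
- move=> [t _ <-]; rewrite -(pu t) kE; case: ifP => _; last exact: ext_graph0.
  by rewrite eg; exists [tuple R t].
- rewrite eg => -[b _ <-].
  (* As [theta m] is total, some stage [a] reveals its diagonal value; pairing [a] with every [b]
     then outputs the whole range of [g]. *)
  have [a _ fa] : range f (pr (code pr (nseq n.+2 m)) (v [tuple m]).+1).
    rewrite -ef; right; exists (nseq_tuple n.+2 m), (v [tuple m]).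
    by rewrite (_ : nseq_tuple _ _ = [tuple of m :: nseq_tuple n.+1 m]);
      [rewrite behead_cons_tuple thm | apply: val_inj].
  exists (pr (thead a) (thead b)) => //.
  have one (x : 1.-tuple nat) : [tuple thead x] = x.
    by apply: eq_from_tnth => i; rewrite ord1.
  rewrite kE !one fa Lpr Rpr eqxx /=.
  by case: asboolP.
- move=> [t _ <-]; rewrite -(pu t) kE; case: ifP => [|_];
    last exact: ext_graph0.
  by move=> /and3P[/eqP Lm R0]; rewrite searchE // => /asboolP.
- move=> [[y _ <-]|[x [w []]]] //.
  (* No stage passes the test, so any will do, here 0. *)
  exists (pr 0 (code pr y)) => //; rewrite kE ifN //.
  by apply/negP => /and3P[/eqP Lm R0]; rewrite searchE // => /asboolP.
Qed.

Lemma computable_setC (I : set nat) : computable_set I -> computable_set (~` I).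
Proof.
move=> hI.
apply: Rfun_ext (Rfun_if hI (Rfun_const 1 1) (Rfun_const 1 0)) => x /=.
by rewrite asbool_neg; case: asboolP.
Qed.

Theorem theorem4p16 (pr : nat -> nat -> nat) (hpr : is_pairing pr)
    (A : set nat) (hAinf : infinite_set A) (hAce : ce_set A)
    (n : nat) (hn : 1 <= n)
    (theta : nat -> partial_fun n) (htheta : quasi_Goedel pr A theta)
    (C : set (partial_fun n)) (hC : C `<=` @SA n A) :
  computable_set [set i | C (theta i)] <-> (C = set0 \/ C = @SA n A).
Proof.
have [range_theta _ _] := htheta.
split=> [hI|[->|->]]; last first.
- apply: Rfun_ext (Rfun_const 1 1) => x; case: asboolP => //= -[].
  by rewrite -range_theta; exists (thead x).
- by apply: Rfun_ext (Rfun_const 1 0) => x; case: asboolP.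
case: n hn theta htheta C hC range_theta hI => // n _ theta htheta C hC _ hI.
(* The set [I] of the diagonal lemma is the index set of [C] or its complement, whichever is the
   side of the nowhere defined function. With [r] on the other side, [theta i] lands on the side
   opposite to that of [i]. *)
have [C0|nC0] := pselect (C (fun=> None)).
  right; apply/seteqP; split=> // r hr; apply: contrapT => nCr.
  have [i thi] := quasi_Goedel_diagonal hpr hI htheta hr.
  by case: asboolP thi => /= [+ thi|+ thi]; rewrite thi.
left; apply/seteqP; split=> // r Cr.
have [i thi] := quasi_Goedel_diagonal hpr (computable_setC hI) htheta (hC _ Cr).
by case: asboolP thi => /= [+ thi|+ thi]; rewrite thi => // /contrapT.
Qed.
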